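(* Let $m\ge 2$ and $n\ge 1$ be integers. If $n \geq R_{m-1}-2m+1$, then $$\mathfrak{pr}(K_{m,n}) \leq 2\left\lceil \frac{n-1}{2}\right\rceil + 2m-1.$$
   Context: All graphs are finite and simple. A coprime labeling of a graph $G$ is an injection $f\colon V(G)\to\{1,2,\dots,k\}$, for some integer $k\ge |V(G)|$, such that $\gcd(f(u),f(v))=1$ whenever $(u,v)\in E(G)$. The minimum coprime number $\mathfrak{pr}(G)$ is the least $k$ for which such a labeling exists. $K_{m,n}$ is the complete bipartite graph with parts of sizes $m$ and $n$. For $k\ge 1$, the $k$-th Ramanujan prime $R_k$ is the least integer such that $\pi(x)-\pi(x/2)\ge k$ for all $x\ge R_k$, where $\pi(x)$ is the number of primes less than or equal to $x$. *)

(* Defs.v *)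
From HB Require Import structures.
From mathcomp Require Import all_boot all_order all_algebra.
From mathcomp Require Import reals.
Set Implicit Arguments.
Unset Strict Implicit.
Unset Printing Implicit Defensive.
Import Order.TTheory GRing.Theory Num.Theory.

Record sgraph := SGraph {
  vertex : finType;
  adj : rel vertex;
  adj_sym : symmetric adj;
  adj_irrefl : irreflexive adj
}.

(* The label set {1, ..., k} is the set of nonzero elements of 'I_k.+1. *)
Definition coprime_labeling (G : sgraph) (k : nat)
    (f : {ffun vertex G -> 'I_k.+1}) : bool :=
  [&& #|vertex G| <= k, injectiveb f, [forall v, 0 < f v]
    & [forall u, forall v, adj u v ==> coprime (f u) (f v)]].

Definition has_coprime_labeling (G : sgraph) (k : nat) : bool :=
  [exists f : {ffun vertex G -> 'I_k.+1}, coprime_labeling f].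

(* Distinct primes as labels. *)
Lemma has_coprime_labeling_ex (G : sgraph) :
  exists k, has_coprime_labeling G k.
Proof.
pose nxt m := s2val (prime_above m).
have nxtP m : prime (nxt m) by exact: (s2valP' (prime_above m)).
have nxt_gt m : m < nxt m by exact: (s2valP (prime_above m)).
pose p i := iter i.+1 nxt 0.
have p_prime i : prime (p i) by rewrite /p iterS.
have p_mono : {homo p : i j / i < j}.
  by apply: homo_ltn => [y x z|i]; [exact: ltn_trans | rewrite /p iterS].
have p_inj : injective p.
  move=> i j eq_ij; case: (ltngtP i j) => // /p_mono; first by rewrite eq_ij ltnn.
  by rewrite eq_ij ltnn.
have p_ge i : i <= p i by elim: i => // i /leq_ltn_trans; apply; exact: p_mono.
set N := #|vertex G|; exists (p N).
have lt_p (v : vertex G) : p (enum_rank v) < (p N).+1.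
  by rewrite ltnS ltnW // p_mono.
apply/existsP; exists [ffun v => Ordinal (lt_p v)].
apply/and4P; split; first exact: p_ge.
- apply/injectiveP => u v; rewrite !ffunE => /(congr1 val) /= /p_inj.
  by move=> /val_inj /enum_rank_inj.
- by apply/forallP => v; rewrite ffunE /= prime_gt0.
apply/forallP => u; apply/forallP => v; apply/implyP => adj_uv.
rewrite !ffunE /= prime_coprime // dvdn_prime2 //.
apply/negP => /eqP /p_inj /val_inj /enum_rank_inj eq_uv.
by move: adj_uv; rewrite eq_uv adj_irrefl.
Qed.

Definition min_coprime_number (G : sgraph) : nat :=
  ex_minn (has_coprime_labeling_ex G).

Definition biclique_adj (m n : nat) : rel ('I_m + 'I_n)%type := fun u v =>
  match u, v with
  | inl _, inr _ | inr _, inl _ => true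
  | _, _ => false
  end.

Lemma biclique_sym (m n : nat) : symmetric (@biclique_adj m n).
Proof. by case=> u [] v. Qed.

Lemma biclique_irrefl (m n : nat) : irreflexive (@biclique_adj m n).
Proof. by case. Qed.

Definition biclique (m n : nat) : sgraph :=
  SGraph (@biclique_sym m n) (@biclique_irrefl m n).

Local Open Scope ring_scope.

(* For negative x, Num.truncn x = 0, so the count is 0. *)
Definition prime_pi (R : realType) (x : R) : nat :=
  count prime (iota 0 (Num.truncn x).+1).

Definition ramanujan_bound (R : realType) (k : nat) (r : int) : Prop :=
  forall x : R, r%:~R <= x ->
    k%:Z <= (prime_pi x)%:Z - (prime_pi (x / 2))%:Z.

(* r is the k-th Ramanujan prime.  Being least, r is unique; the existence of
   the k-th Ramanujan prime is a theorem of Ramanujan, which a relation does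
   not need. *)
Definition is_ramanujan_prime (R : realType) (k : nat) (r : int) : Prop :=
  ramanujan_bound R k r /\ forall s : int, ramanujan_bound R k s -> r <= s.

(* Main.v *)
Require Import Defs.
From mathcomp Require Import all_boot all_order all_algebra.
From mathcomp Require Import reals.
From mathcomp Require Import zify.
Import Order.TTheory GRing.Theory Num.Theory.

(** Put [h = uphalf (n - 1) + m], so that the claimed bound is [2 * h - 1].  A
    prime [p] with [h < p < 2 * h] divides no other number in [1, 2 * h - 1],
    since its next multiple [2 * p] is already too large.  The label [1] and
    any [m - 1] such primes can therefore all go to one side of the biclique,
    and the other side may take any of the remaining labels below [2 * h]
    ([min_coprime_number_biclique_le]).

    The primes are supplied by the Ramanujan bound at the real number [2 * h]
    ([ramanujan_bound_double]).  The even number [2 * h] is used rather than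
    the largest label [2 * h - 1]: the hypothesis on [n] gives [r <= 2 * h]
    whatever the parity of [n], and since [2 * h > 2] is not prime, the count
    over the interval from [h] to [2 * h] is not changed by its right end. *)

Lemma min_coprime_number_le (G : sgraph) (k : nat) :
  has_coprime_labeling G k -> min_coprime_number G <= k.
Proof.
by rewrite /min_coprime_number; case: ex_minnP => j _ min_j; exact: min_j.
Qed.

(** The labels of the two sides are given as lists, so that subsets of
    [1, k] can be produced by filtering and truncating [iota]. *)
Lemma biclique_has_coprime_labeling (k : nat) (s t : seq nat) :
    uniq (s ++ t) -> {in s ++ t, forall x, 0 < x <= k} ->
    {in s & t, forall x y, coprime x y} ->
  has_coprime_labeling (biclique (size s) (size t)) k.
Proof.
move=> uniq_st st_k co_st.
pose lab (v : 'I_(size s) + 'I_(size t)) : nat :=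
  nth 0 (s ++ t) (match v with inl i => i | inr j => size s + j end).
have lab_inl i : lab (inl i) = nth 0 s i by rewrite /lab nth_cat ltn_ord.
have lab_inr j : lab (inr j) = nth 0 t j.
  by rewrite /lab nth_cat ltnNge leq_addr addKn.
have lab_mem v : lab v \in s ++ t.
  by apply: mem_nth; rewrite size_cat; case: v => i /=; have := ltn_ord i; lia.
have lab_inj : injective lab.
  move=> u v /eqP; rewrite nth_uniq //; last 2 first.
  - by rewrite size_cat; case: u => i /=; have := ltn_ord i; lia.
  - by rewrite size_cat; case: v => i /=; have := ltn_ord i; lia.
  case: u v => i [] j /= /eqP.
  - by move=> /val_inj ->.
  - by have := ltn_ord i; lia.
  - by have := ltn_ord j; lia.
  - by move=> /addnI /val_inj ->.
have lab_lt v : lab v < k.+1 by have /andP[] := st_k _ (lab_mem v).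
apply/existsP; exists [ffun v => Ordinal (lab_lt v)].
apply/and4P; split.
- rewrite card_sum !card_ord -size_cat -(size_iota 1 k).
  apply: uniq_leq_size uniq_st _ => x /st_k.
  by rewrite mem_iota add1n ltnS.
- by apply/injectiveP => u v; rewrite !ffunE => /(congr1 val) /lab_inj.
- by apply/forallP => v; rewrite ffunE; have /andP[] := st_k _ (lab_mem v).
apply/forallP => u; apply/forallP => v; apply/implyP; rewrite !ffunE /=.
case: u v => i [] j // _; rewrite lab_inl lab_inr; last rewrite coprime_sym.
  by apply: co_st; exact: mem_nth.
by apply: co_st; exact: mem_nth.
Qed.

(** The least multiple of [p] other than [p] itself is [2 * p], which exceeds
    [2 * h]. *)
Lemma coprime_prime_gt_half (h p x : nat) :
  prime p -> h < p -> 0 < x <= 2 * h -> x != p -> coprime p x.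
Proof.
move=> p_pr lt_hp x_h neq_xp; rewrite prime_coprime //.
by apply/negP => /dvdnP[[|[|q]] def_x]; lia.
Qed.

Lemma min_coprime_number_biclique_le (m n h : nat) :
    1 < h -> m + n <= 2 * h - 1 -> m <= (count prime (iota h.+1 h)).+1 ->
  min_coprime_number (biclique m n) <= 2 * h - 1.
Proof.
move=> h_gt1 le_mn_h le_m_pr; apply: min_coprime_number_le.
pose s := take m (1 :: [seq p <- iota h.+1 h | prime p]).
pose t := take n [seq x <- iota 1 (2 * h - 1) | x \notin s].
have size_s : size s = m by rewrite size_takel //= size_filter.
have s_mem x : x \in s -> x = 1 \/ prime x /\ h < x <= 2 * h - 1.
  move/mem_take; rewrite inE => /predU1P[|]; first by left.
  rewrite mem_filter mem_iota => /andP[x_pr x_h]; right; split=> //.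
  (* The end point [2 * h] lies in the range of [iota], but is composite. *)
  have neq_x : x <> 2 * h.
    by move=> def_x; have := even_prime x_pr; rewrite def_x mul2n odd_double; lia.
  by move: x_h neq_x; lia.
have t_mem x : x \in t -> x \notin s /\ 0 < x <= 2 * h - 1.
  by move/mem_take; rewrite mem_filter mem_iota => /andP[-> ?]; split=> //; lia.
have uniq_s : uniq s.
  apply: take_uniq; rewrite /= filter_uniq ?iota_uniq // andbT.
  by rewrite mem_filter.
have size_t : size t = n.
  rewrite size_takel // size_filter.
  have := count_predC (mem s) (iota 1 (2 * h - 1)); rewrite size_iota.
  have : count (mem s) (iota 1 (2 * h - 1)) <= m.
    rewrite -size_filter -size_s; apply: uniq_leq_size.
      by rewrite filter_uniq ?iota_uniq.
    by move=> x; rewrite mem_filter => /andP[].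
  rewrite (@eq_count _ (predC (mem s)) (fun x => x \notin s)) //.
  by lia.
rewrite -{}size_s -{}size_t; apply: biclique_has_coprime_labeling.
- rewrite cat_uniq uniq_s take_uniq ?filter_uniq ?iota_uniq // andbT.
  by apply/hasPn => x /t_mem[].
- by move=> x; rewrite mem_cat => /orP[/s_mem[->|[_]]|/t_mem[_]] //; lia.
move=> x y s_x /t_mem[s'y y_h]; have [->|[x_pr x_h]] := s_mem x s_x.
  exact: coprime1n.
apply: (coprime_prime_gt_half h) => //; first by case/andP: x_h.
- by lia.
- by apply: contraNneq s'y => ->.
Qed.

Lemma prime_pi_natr (R : realType) (n : nat) :
  prime_pi (n%:R%R : R) = count prime (iota 0 n.+1).
Proof. by rewrite /prime_pi natrK. Qed.

Lemma ramanujan_bound_double (R : realType) (k h : nat) (r : int) :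
    ramanujan_bound R k r -> (r <= (2 * h)%:Z)%R ->
  k <= count prime (iota h.+1 h).
Proof.
move=> bound_r le_r_h.
have := bound_r (2 * h)%:Z%:~R%R; rewrite ler_int => /(_ le_r_h).
rewrite -pmulrn prime_pi_natr.
have -> : ((2 * h)%:R / 2 = h%:R :> R)%R.
  by rewrite natrM mulrC mulKf // pnatr_eq0.
rewrite prime_pi_natr (_ : (2 * h).+1 = h.+1 + h); last by lia.
by rewrite iotaD count_cat add0n; lia.
Qed.

Theorem corollary4p1 (R : realType) (m n : nat) (r : int)
  (hm : (2 <= m)%N) (hn : (1 <= n)%N)
  (hr : is_ramanujan_prime R (m - 1)%N r)
  (hnr : (r - 2 * m%:Z + 1 <= n%:Z)%R) :
  (min_coprime_number (biclique m n) <= 2 * uphalf (n - 1) + 2 * m - 1)%N.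
Proof.
have [bound_r _] := hr.
have le_n_half : n - 1 <= 2 * uphalf (n - 1).
  by rewrite mul2n uphalf_half doubleD; have := odd_double_half (n - 1); lia.
rewrite -mulnDr; apply: min_coprime_number_biclique_le; try lia.
have := @ramanujan_bound_double R (m - 1) (uphalf (n - 1) + m) r bound_r.
lia.
Qed.
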